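(* Let $A \in \mathbb{R}^{n\times n}$, $B \in \mathbb{R}^{n\times m}$, $K \in \mathbb{R}^{m\times n}$. If $v \in \mathbb{R}^m$ is such that $\|v\|_\infty \le 1$, then for all $e \in \mathbb{R}^n$ the vector $f(e,v) = Ae + B\left(\varphi(Ke+v) - v\right)$ satisfies $f(e,v) \in F(e)$, where $$F(e) = \mathrm{co}\left(\left\{ \Big(A + \sum_{i\in J} B_{(i)}K_i\Big)e \right\}_{J \subseteq \{1,\dots,m\}}\right).$$
   Context: $\varphi:\mathbb{R}^m\to\mathbb{R}^m$ is the componentwise saturation function $\varphi_i(u) = \mathrm{sign}(u_i)\min\{|u_i|,1\}$, $i=1,\dots,m$. $B_{(i)}$ is the $i$-th column of $B$ and $K_i$ is the $i$-th row of $K$, so $B_{(i)}K_i \in \mathbb{R}^{n\times n}$. $\mathrm{co}$ denotes the convex hull; the family ranges over all subsets $J$ of $\{1,\dots,m\}$, including the empty set. $\|v\|_\infty = \max_i |v_i|$. *)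

(* Defs.v *)
From HB Require Import structures.
From mathcomp Require Import all_boot all_order all_algebra.
From mathcomp Require Import all_classical all_reals all_analysis.

Set Implicit Arguments.
Unset Strict Implicit.
Unset Printing Implicit Defensive.

Import Order.TTheory GRing.Theory Num.Theory.
Import numFieldNormedType.Exports.

Local Open Scope classical_set_scope.
Local Open Scope ring_scope.

Definition sat (R : realType) (m : nat) (u : 'cV[R]_m) : 'cV[R]_m :=
  \col_i (Num.sg (u i 0) * Num.min `|u i 0| 1).

Definition convex_hull (R : realType) (V : lmodType R) (S : set V) : set V :=
  smallest [set X : set V | convex_set X] S.

Definition sat_field (R : realType) (n m : nat) (A : 'M[R]_n)
    (B : 'M[R]_(n, m)) (K : 'M[R]_(m, n)) (e : 'cV[R]_n) (v : 'cV[R]_m) :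
    'cV[R]_n :=
  A *m e + B *m (sat (K *m e + v) - v).

Definition sat_inclusion (R : realType) (n m : nat) (A : 'M[R]_n)
    (B : 'M[R]_(n, m)) (K : 'M[R]_(m, n)) (e : 'cV[R]_n) : set 'cV[R]_n :=
  convex_hull
    (range (fun J : {set 'I_m} =>
              (A + \sum_(i in J) col i B *m row i K) *m e)).

(* Main.v *)
(* Since |v_i| <= 1, the increment phi_i(Ke + v) - v_i lies between 0 and
   (Ke)_i, so it equals t_i (Ke)_i for some t_i in [0, 1]. Hence f(e, v) is
   Ae + \sum_i t_i B_(i) K_i e, a point of a parallelotope whose vertices are
   the generators of F(e); such a point is a convex combination of the vertices,
   one coordinate being averaged at a time. *)
Require Import Defs.
From mathcomp Require Import all_boot all_order all_algebra.
From mathcomp Require Import all_classical all_reals all_analysis.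
From mathcomp Require Import ring lra.

Import Order.TTheory GRing.Theory Num.Theory.
Import numFieldNormedType.Exports.

Local Open Scope classical_set_scope.
Local Open Scope ring_scope.

Lemma sat1_increment (R : realType) (k w : R) : `|w| <= 1 ->
  exists2 t : R, 0 <= t <= 1 &
    Num.sg (k + w) * Num.min `|k + w| 1 - w = t * k.
Proof.
rewrite ler_norml => /andP[w_ge w_le].
have [u_le1|] := leP `|k + w| 1.
  by exists 1; rewrite ?ler01 ?lexx// -numEsg mul1r addrK.
(* In the saturated case the value is 1 or -1; as [w] lies in [-1, 1], [k] is nonzero with that same
   sign, so [t] can be found by dividing by [k]. *)
rewrite mulr1 lter_normr => /orP[u_gt1|u_ltN1].
- have k_gt0 : 0 < k by lra.
  exists ((1 - w) / k); last first.
    by rewrite gtr0_sg ?(lt_trans ltr01)// divfK ?gt_eqF.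
  by rewrite divr_ge0 ?ler_pdivrMr ?subr_ge0 ?(ltW k_gt0)//=; lra.
- have k_lt0 : k < 0 by lra.
  exists ((-1 - w) / k); last first.
    by rewrite ltr0_sg ?divfK ?lt_eqF//; lra.
  by rewrite ler_ndivrMr// -mulrNN -invrN divr_ge0 ?oppr_ge0 ?(ltW k_lt0)//=; lra.
Qed.

Lemma convex_set_lmodP (R : numDomainType) (V : lmodType R) (X : set V) (t : R)
    (x y : V) : convex_set X -> 0 <= t <= 1 -> X x -> X y ->
  X (t *: x + (1 - t) *: y).
Proof.
move=> convX /andP[t_ge0 t_le1] /mem_set Xx /mem_set Xy.
exact: set_mem (convX x y (Itv01 t_ge0 t_le1) Xx Xy).
Qed.

Lemma parallelotope_convex (R : numDomainType) (V : lmodType R) (I : finType)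
    (X : set V) (w : I -> V) (t : I -> R) (a : V) :
  convex_set X -> (forall i, 0 <= t i <= 1) ->
  (forall J : {set I}, X (a + \sum_(i in J) w i)) ->
  X (a + \sum_i t i *: w i).
Proof.
move=> convX t01 XJ.
(* Invariant: indices in [s] carry their weight [t i], those in [J] weight 1, all others 0. When [s]
   enumerates [I], disjointness leaves only the empty [J]. *)
suff XsJ (s : seq I) : uniq s -> forall J : {set I}, {in s, forall i, i \notin J} ->
    X (a + \sum_(i in J) w i + \sum_(i <- s) t i *: w i).
  have /(_ finset.set0) := XsJ _ (index_enum_uniq I).
  by rewrite finset.big_set0 addr0; apply=> i _; rewrite inE.
elim: s => [_ J _|i s IHs /= /andP[i_notin_s uniq_s] J sJ].
  by rewrite big_nil addr0.
have iJ : i \notin J by rewrite sJ ?mem_head.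
(* [X0] and [X1] differ only in the weight of [w i], 0 against 1; mixing them with ratio [t i] gives
   it weight [t i]. *)
have X0 := IHs uniq_s J (fun j js => sJ j (mem_behead (s := i :: s) js)).
have X1 : X (a + \sum_(j in i |: J) w j + \sum_(j <- s) t j *: w j).
  apply: IHs => // j js; rewrite !inE negb_or sJ ?inE ?js ?orbT// andbT.
  by apply: contraNneq i_notin_s => <-.
have := convex_set_lmodP _ _ _ _ _ _ convX (t01 i) X1 X0.
rewrite big_setU1//= big_cons; congr X.
set S := \sum_(j in J) _; set T := \sum_(j <- s) _.
have -> : a + (w i + S) + T = w i + (a + S + T).
  by rewrite addrCA !addrA.
by rewrite scalerDr -addrA -scalerDl [t i + _]addrC subrK scale1r addrCA.
Qed.

Lemma mulmx_sum_col (R : comPzRingType) (n m : nat) (B : 'M[R]_(n, m))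
    (u : 'cV[R]_m) : B *m u = \sum_i u i 0 *: col i B.
Proof.
apply/colP => j; rewrite mxE summxE; apply: eq_bigr => i _.
by rewrite !mxE mulrC.
Qed.

(* MathComp-Analysis; the norm on column vectors is the max norm [mx_norm]. *)
Theorem theorem2 (R : realType) (n m : nat) (A : 'M[R]_n) (B : 'M[R]_(n, m))
    (K : 'M[R]_(m, n)) (v : 'cV[R]_m) (hv : `|v| <= 1) (e : 'cV[R]_n) :
  sat_inclusion A B K e (sat_field A B K e v).
Proof.
(* The hull is an intersection, so an arbitrary convex [X] containing the generators is fixed; no
   explicit vertex weights are needed. *)
move=> X [convX XJ].
have v_le1 i : `|v i 0| <= 1.
  by apply: le_trans hv; rewrite [leRHS]mx_normrE; exact: (le_bigmax _ _ (i, 0)).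
have sat_inc i : exists t : R, 0 <= t <= 1 /\
    (sat (K *m e + v) - v) i 0 = t * (K *m e) i 0.
  have [t t01 tE] := sat1_increment _ ((K *m e) i 0) _ (v_le1 i).
  by exists t; split=> //; rewrite -tE !mxE.
have [t tP] := choice sat_inc.
rewrite /sat_field [B *m _]mulmx_sum_col.
under eq_bigr => i _ do rewrite (tP i).2 -scalerA.
apply: parallelotope_convex => // [i|J]; first exact: (tP i).1.
apply: XJ; exists J => //.
rewrite mulmxDl mulmx_suml; congr (_ + _); apply: eq_bigr => i _.
(* [row i K *m e] is the 1 by 1 matrix with entry [(K *m e) i 0], hence acts on [col i B] as a
   scalar. *)
rewrite -mulmxA; apply/colP => j.
by rewrite !mxE big_ord1 !mxE mulrC; under eq_bigr do rewrite mxE.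
Qed.
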